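(* Let $G$ be a finite abelian group of order $v=qh$, and suppose that $G$ has a subgroup $H$ of odd order $h$. If $G$ has a $(v,v-1,\lambda)$-SDS, then \[ v-1+\lambda(h-1)\equiv q-1 \pmod 8\quad\text{or}\quad v-1+\lambda(h-1)\equiv q+3\pmod 8 . \]
   Context: Let $G$ be a finite group of order $v$, with identity denoted $0_G$. In the integral group ring $\mathbb Z[G]$, identify a subset $U\subseteq G$ with $\sum_{u\in U}u$, and for $D=\sum_{g\in G}a_g g$ write $D^{(-1)}=\sum_{g\in G}a_g g^{-1}$. A signed subset of $G$ is an element $D=\sum_{g\in G}a_g g\in\mathbb Z[G]$ with all $a_g\in\{0,1,-1\}$; its support size is $k=|\{g\in G: a_g\neq 0\}|$. A signed subset $D$ of support size $k$ is a $(v,k,\lambda)$-signed difference set (SDS), with $\lambda\in\mathbb Z$, if $DD^{(-1)}=(k-\lambda)0_G+\lambda G$ in $\mathbb Z[G]$ (so the coefficient of the identity is $k$ and every other coefficient is $\lambda$). *)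

(* Defs.v *)
From mathcomp Require Import all_boot all_order all_algebra all_fingroup.

Set Implicit Arguments.
Unset Strict Implicit.
Unset Printing Implicit Defensive.

Import GRing.Theory.
Local Open Scope ring_scope.

(* The group G is the whole finGroupType gT; an element sum_g a_g g of Z[G] is
   its coefficient function g |-> a_g.  Addition and integer multiples are the
   library's pointwise ones, but the product of Z[G] is the convolution gr_mul,
   not a pointwise product. *)
Definition group_ring (gT : finGroupType) := {ffun gT -> int}.

Definition gr_mul (gT : finGroupType) (D E : group_ring gT) : group_ring gT :=
  [ffun g => \sum_(p : gT * gT | (p.1 * p.2)%g == g) D p.1 * E p.2].

(* D^(-1): the coefficient at g of sum_x D_x x^-1 is the one of D at g^-1. *)
Definition gr_conj (gT : finGroupType) (D : group_ring gT) : group_ring gT :=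
  [ffun g => D (g^-1)%g].

Definition gr_set (gT : finGroupType) (U : {set gT}) : group_ring gT :=
  [ffun g => (g \in U)%:R].

Definition signed_subset (gT : finGroupType) (D : group_ring gT) : Prop :=
  forall g, D g \in [:: 0; 1; -1].

Definition support_size (gT : finGroupType) (D : group_ring gT) : nat :=
  #|[set g | D g != 0]|.

Definition is_SDS (gT : finGroupType) (v k : nat) (lambda : int)
    (D : group_ring gT) : Prop :=
  [/\ #|gT| = v, signed_subset D, support_size D = k &
      gr_mul D (gr_conj D) =
        gr_set [set 1%g] *~ (k%:Z - lambda) + gr_set [set: gT] *~ lambda].

(* Main.v *)
Require Import Defs.
From mathcomp Require Import all_boot all_order all_algebra all_fingroup.
From mathcomp Require Import ring zify.

(** Sum the coefficients of the signed difference set D over each of the q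
    right cosets of H.  The squares of these coset sums add up to the sum over
    H of the coefficients of D D^(-1), because x and y lie in the same right
    coset exactly when x y^-1 is in H; by the difference set equation
    ([SDS_sum_subgroup]) this is (v - 1) + lambda (h - 1).

    The same total is determined modulo 8 up to one bit by parity.  As D
    vanishes at a single point z, a coset that avoids z contributes the square
    of a sum of h signs, and h is odd: an odd square, congruent to 1.  The coset
    through z contributes the square of a sum of h - 1 signs: an even square,
    congruent to 0 or 4.  Hence the total is q - 1 or q + 3 modulo 8. *)

Import GRing.Theory.
Local Open Scope ring_scope.

Definition set_sum {gT : finGroupType} (D : group_ring gT) (A : {set gT}) :
    int := \sum_(x in A) D x.

Lemma gr_mul_conjE {gT : finGroupType} (D : group_ring gT) (g : gT) :
  gr_mul D (gr_conj D) g = \sum_x D (g * x)%g * D x.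
Proof.
rewrite ffunE (reindex_onto (fun x => (g * x, x^-1)%g) (fun p => (p.2^-1)%g)).
  apply: eq_big => [x | x _] /=; last by rewrite ffunE invgK.
  by rewrite mulgK invgK !eqxx.
by case=> a b /= /eqP <-; rewrite mulgK invgK.
Qed.

(** A pair of elements inside a common right coset of H is a pair (a x, x) with
    a in H.  For H normal, the common value is the coefficient at the identity
    of the image of D D^(-1) in the group ring of the quotient by H. *)
Lemma sum_sqr_rcosets {gT : finGroupType} (D : group_ring gT)
    (H : {group gT}) :
  \sum_(C in rcosets H [set: gT]) set_sum D C ^+ 2 =
  \sum_(a in H) gr_mul D (gr_conj D) a.
Proof.
have trivP : trivIset (rcosets H [set: gT]).
  by case/and3P: (rcosets_partition (subsetT H)).
have coverP : cover (rcosets H [set: gT]) = [set: gT].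
  by apply/eqP; case/and3P: (rcosets_partition (subsetT H)).
transitivity (\sum_x set_sum D (H :* x)%g * D x).
  transitivity (\sum_(x in cover (rcosets H [set: gT]))
                   set_sum D (H :* x)%g * D x).
    rewrite big_trivIset //; apply: eq_bigr => C /rcosetsP [y _ ->].
    rewrite expr2 {2}/set_sum mulr_sumr; apply: eq_bigr => x xHy.
    by rewrite (rcoset_eqP xHy).
  by rewrite coverP; apply: eq_bigl => x; rewrite inE.
under [RHS]eq_bigr => a _ do rewrite gr_mul_conjE.
rewrite exchange_big; apply: eq_bigr => x _.
rewrite /set_sum -mulr_suml; congr (_ * _).
rewrite (reindex_inj (mulIg x)) /=; apply: eq_bigl => a.
by rewrite mem_rcoset mulgK.
Qed.

(** Both signs are congruent to 1 modulo 2, so a sum of signs has the parity of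
    the number of its terms. *)
Lemma set_sum_parity {gT : finGroupType} (D : group_ring gT) (A : {set gT}) :
    (forall x, x \in A -> (D x == 1) || (D x == -1)) ->
  (2 %| set_sum D A - (odd #|A|)%:Z)%Z.
Proof.
move=> sgnA.
have sum_card : (2 %| set_sum D A - #|A|%:Z)%Z.
  rewrite -sum1_card -natz natr_sum /set_sum -sumrB.
  by apply: rpred_sum => x /sgnA /orP[] /eqP ->.
have card_odd : (2 %| #|A|%:Z - (odd #|A|)%:Z)%Z.
  rewrite -[in #|A|%:Z](odd_double_half #|A|) PoszD addrC addKr.
  by rewrite -muln2 PoszM dvdz_mull.
by have := rpredD sum_card card_odd; rewrite addrA subrK.
Qed.

Lemma SDS_sum_subgroup {gT : finGroupType} {v k : nat} {lambda : int}
    {D : group_ring gT} (H : {group gT}) :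
  is_SDS v k lambda D ->
  \sum_(a in H) gr_mul D (gr_conj D) a = k%:Z + lambda * (#|H|%:Z - 1).
Proof.
case=> _ _ _ eqD; rewrite (bigD1 1%g) //= eqD.
have coef a :
    (gr_set [set 1%g : gT] *~ (k%:Z - lambda) + gr_set [set: gT] *~ lambda) a
    = (a == 1%g)%:R * (k%:Z - lambda) + lambda.
  have mulzE (E : group_ring gT) (n : int) : (E *~ n) a = E a * n.
    case: n => n; first by rewrite -pmulrn ffunMnE -mulr_natr natz.
    by rewrite NegzE mulrNz -pmulrn ffunE ffunMnE mulrN -mulr_natr natz.
  by rewrite ffunE !mulzE !ffunE !inE mul1r.
rewrite coef eqxx.
rewrite (eq_bigr (fun=> lambda)) => [|a /andP[_ /negPf aN1]]; last first.
  by rewrite coef aN1 mul0r add0r.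
rewrite sumr_const (cardD1 1%g H) group1.
have -> : #|[pred i in H | i != 1%g]| = #|[predD1 H & 1%g]|.
  by apply: eq_card => a; rewrite !inE andbC.
rewrite PoszD -[lambda *+ _]mulr_natr natz /=; ring.
Qed.

(** For b = 2 c + 1 one has b^2 - 1 = 4 c (c + 1), and one of c, c + 1 is
    even. *)
Lemma sqr_odd_mod8 (b : int) : (2 %| b - 1)%Z -> (8 %| b ^+ 2 - 1)%Z.
Proof.
case/dvdzP=> c bE; have -> : b ^+ 2 - 1 = 4 * (c * (c + 1)).
  have -> : b = c * 2 + 1 by lia.
  ring.
have [d] : exists d, c = 2 * d \/ c = 2 * d + 1 by exists (c %/ 2)%Z; lia.
by case=> ->; apply/dvdzP; [exists (d * (2 * d + 1)) |
  exists ((2 * d + 1) * (d + 1))]; ring.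
Qed.

Lemma sqr_even_mod8 (b : int) :
  (2 %| b)%Z -> (8 %| b ^+ 2)%Z \/ (8 %| b ^+ 2 - 4)%Z.
Proof.
case/dvdzP=> c ->.
have [d] : exists d, c = 2 * d \/ c = 2 * d + 1 by exists (c %/ 2)%Z; lia.
case=> ->; [left | right]; apply/dvdzP.
  by exists (2 * d ^+ 2); ring.
by exists (2 * d * (d + 1)); ring.
Qed.

Theorem theorem4p4 (gT : finGroupType) (v q h : nat) (lambda : int)
    (H : {group gT}) :
  abelian [set: gT] -> #|gT| = v -> v = (q * h)%N ->
  #|H| = h -> odd h ->
  (exists D : group_ring gT, is_SDS v (v - 1)%N lambda D) ->
  (v%:Z - 1 + lambda * (h%:Z - 1) = q%:Z - 1 %[mod 8])%Z \/
  (v%:Z - 1 + lambda * (h%:Z - 1) = q%:Z + 3 %[mod 8])%Z.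
Proof.
move=> _ cardG vE cardH odd_h [D sdsD].
have v_gt0 : (0 < v)%N by rewrite -cardG (cardD1 1%g).
have [_ sgnD suppD _] := sdsD.
(* Support size v - 1 means that exactly one coefficient vanishes. *)
have [z zeroD] : exists z, [set g | D g == 0] = [set z].
  apply/cards1P; have := cardsC [set g | D g != 0].
  rewrite -/(support_size D) suppD cardG.
  have -> : ~: [set g | D g != 0] = [set g | D g == 0].
    by apply/setP => g; rewrite !inE negbK.
  by move=> ?; apply/eqP; lia.
have Dz : D z = 0 by apply/eqP; have := set11 z; rewrite -zeroD inE.
have sgn x : x != z -> (D x == 1) || (D x == -1).
  move=> xNz; have := sgnD x; rewrite !inE => /orP[Dx0|//].
  by move: xNz; rewrite -in_set1 -zeroD inE Dx0.
have total : \sum_(C in rcosets H [set: gT]) set_sum D C ^+ 2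
    = v%:Z - 1 + lambda * (h%:Z - 1).
  by rewrite sum_sqr_rcosets (SDS_sum_subgroup H sdsD) cardH; lia.
have card_cosets : #|rcosets H [set: gT]| = q.
  have := Lagrange (subsetT H); rewrite cardsT cardG cardH vE /indexg.
  by rewrite mulnC => /eqP; rewrite eqn_pmul2r ?odd_gt0 // => /eqP.
have zcoset : (H :* z)%g \in rcosets H [set: gT].
  by apply/rcosetsP; exists z; rewrite ?inE.
have oddC C : C \in rcosets H [set: gT] -> odd #|C|.
  by case/rcosetsP=> x _ ->; rewrite card_rcoset cardH.
have away : (8 %| \sum_(C in rcosets H [set: gT] | C != (H :* z)%g)
                    set_sum D C ^+ 2 - (q%:Z - 1))%Z.
  have -> : q%:Z - 1 =
      \sum_(C in rcosets H [set: gT] | C != (H :* z)%g) (1 : int).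
    have := cardD1 (H :* z)%g (mem (rcosets H [set: gT])).
    rewrite card_cosets zcoset => ->; rewrite sumr_const natz.
    have -> : #|[predD1 rcosets H [set: gT] & (H :* z)%g]| =
        #|[pred C in rcosets H [set: gT] | C != (H :* z)%g]|.
      by apply: eq_card => C; rewrite !inE andbC.
    by rewrite PoszD addrAC subrr add0r.
  rewrite -sumrB; apply: rpred_sum => C /andP[CH CNz].
  apply: sqr_odd_mod8.
  have /(set_sum_parity D) : forall x, x \in C -> (D x == 1) || (D x == -1).
    move=> x xC; apply: sgn; apply: contraNneq CNz => xz.
    by case/rcosetsP: CH xC => y _ ->; rewrite xz => /rcoset_eqP ->.
  by rewrite oddC.
have evenz : (2 %| set_sum D (H :* z)%g)%Z.
  (* The zero coefficient at z can be dropped, leaving h - 1 signs. *)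
  have -> : set_sum D (H :* z)%g = set_sum D ((H :* z) :\ z)%g.
    rewrite /set_sum (big_setD1 z) ?rcoset_refl //=.
    by rewrite Dz add0r.
  have /(set_sum_parity D) :
      forall x, x \in ((H :* z) :\ z)%g -> (D x == 1) || (D x == -1).
    by move=> x; rewrite in_setD1 => /andP[/sgn].
  have := oddC _ zcoset.
  by rewrite (cardsD1 z (H :* z)%g) rcoset_refl /= => /negPf ->; rewrite subr0.
rewrite -total (bigD1 (H :* z)%g) //=.
have [even0 | even4] := sqr_even_mod8 _ evenz; [left | right];
  apply/eqP; rewrite eqz_mod_dvd.
  by have := rpredD even0 away; congr (_ %| _)%Z; ring.
by have := rpredD even4 away; congr (_ %| _)%Z; ring.
Qed.
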